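(* Let all the first order derivatives of the $k$-vector function $\psi(\eta)$ $(\eta\in S\subset E_k)$ exist and be continuous. If the subset $S$ of $E_k$ is closed and bounded and the inequality $$\det[J_\eta(\psi)]\ne 0\qquad(\eta\in S)$$ is valid, then the following statements hold. 1. The set of extremal points of the $k$-vector function $\psi(\eta)$, where $\eta$ belongs to $S\subset E_k$, is not empty. 2. All the extremal points of the $k$-vector function $\psi(\eta)$ $(\eta\in S)$ belong to the boundary of the subset $S$.
   Context: $E_k$ ($k\ge 1$) denotes the $k$-dimensional space of vectors $X=[x_1,\dots,x_k]$ with real elements, with norm $\|X\|=\max_{1\le p\le k}|x_p|$ and with the partial order: $X>Y$ if all the elements of $X-Y$ are non-negative and at least one of them is positive. A $k$-vector function is a function with values in $E_k$. $J_\eta(\psi)$ is the $k\times k$ Jacobian matrix of $\psi$ at $\eta$, with entries $\partial\psi_i/\partial\eta_j$. A vector $X$ in a semi-ordered (partially ordered) set is called maximal (minimal) if there is no other element of the set greater (lesser) than $X$. The extremal points of $\psi$ on $S$ are the points $\eta\in S$ at which $\psi(\eta)$ takes a value that is maximal or minimal for the set $\{\psi(\eta):\eta\in S\}$. *)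

(* Defs.v *)
From HB Require Import structures.
From mathcomp Require Import all_boot all_order all_algebra.
From mathcomp Require Import all_classical all_reals all_analysis.
Import Order.TTheory GRing.Theory Num.Theory numFieldNormedType.Exports.

Set Implicit Arguments.
Unset Strict Implicit.
Unset Printing Implicit Defensive.

Local Open Scope classical_set_scope.
Local Open Scope ring_scope.

(* E_k is 'rV[R]_k: the library norm on matrices is the max norm. *)

(* The strict order X > Y on E_k; not coordinatewise strict. *)
Definition vgt (R : realType) (k : nat) (X Y : 'rV[R]_k) : Prop :=
  (forall p : 'I_k, 0 <= (X - Y) ord0 p) /\
  (exists p : 'I_k, 0 < (X - Y) ord0 p).

Definition is_maximal (R : realType) (k : nat) (A : set 'rV[R]_k)
    (X : 'rV[R]_k) : Prop :=
  A X /\ ~ (exists2 Y, A Y & vgt Y X).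

Definition is_minimal (R : realType) (k : nat) (A : set 'rV[R]_k)
    (X : 'rV[R]_k) : Prop :=
  A X /\ ~ (exists2 Y, A Y & vgt X Y).

Definition extremal_points (R : realType) (k : nat)
    (psi : 'rV[R]_k -> 'rV[R]_k) (S : set 'rV[R]_k) : set 'rV[R]_k :=
  [set eta | S eta /\
    (is_maximal (psi @` S) (psi eta) \/ is_minimal (psi @` S) (psi eta))].

Definition component (R : realType) (k : nat) (psi : 'rV[R]_k -> 'rV[R]_k)
    (i : 'I_k) : 'rV[R]_k -> R :=
  fun eta => psi eta ord0 i.

Definition basis_vector (R : realType) (k : nat) (j : 'I_k) : 'rV[R]_k :=
  delta_mx ord0 j.

(* d psi_i / d eta_j, meaningful where the directional derivative exists. *)
Definition partial (R : realType) (k : nat) (psi : 'rV[R]_k -> 'rV[R]_k)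
    (i j : 'I_k) : 'rV[R]_k -> R :=
  fun eta => 'D_(basis_vector R j) (component psi i) eta.

(* The library's jacobian is the matrix of the Frechet differential acting on
   row vectors, i.e. the transpose of this one, and it presupposes
   differentiability rather than existence of the partial derivatives. *)
Definition Jacobian (R : realType) (k : nat) (psi : 'rV[R]_k -> 'rV[R]_k)
    (eta : 'rV[R]_k) : 'M[R]_k :=
  \matrix_(i < k, j < k) partial psi i j eta.

(* S need not be open, so a two-sided partial derivative at a point of S uses
   values of psi off S: the partial derivatives are required to exist near each
   point of S and to be continuous, as functions on E_k, at each point of S.
   Any psi that is C^1 on an open neighbourhood of S qualifies. Existence on S
   with continuity relative to S would not even make psi continuous on S. *)
Definition C1_on (R : realType) (k : nat) (psi : 'rV[R]_k -> 'rV[R]_k)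
    (S : set 'rV[R]_k) : Prop :=
  forall eta, S eta -> forall i j : 'I_k,
    (\forall z \near eta, derivable (component psi i) z (basis_vector R j)) /\
    {for eta, continuous (partial psi i j)}.

Definition boundary (T : topologicalType) (S : set T) : set T :=
  closure S `\` interior S.

(* Main.v *)
Require Import Defs.
From HB Require Import structures.
From mathcomp Require Import all_boot all_order all_algebra.
From mathcomp Require Import all_classical all_reals all_analysis.
From mathcomp Require Import ring.
Import Order.TTheory GRing.Theory Num.Theory numFieldNormedType.Exports.
Local Open Scope classical_set_scope.
Local Open Scope ring_scope.

Set Implicit Arguments.
Unset Strict Implicit.
Unset Printing Implicit Defensive.

(** Extremal points exist because the sum of the components of [psi] is strictly
monotone for the partial order: a point of the compact set [S] where this sum is
largest has a maximal value, since any greater value would have a larger sum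
([exists_extremal_point]).

An extremal point cannot be interior because an invertible Jacobian lets one
prescribe the first-order variation of all the components at once.  Solving
[J v = (1, ..., 1)] gives a direction [v] along which every component has
derivative 1; at an interior point, a small step along [v] stays in [S] and
increases every component, and a small step along [-v] decreases every component
([interior_straddled]).  So the value at an interior point is neither maximal nor
minimal.

Both arguments rest on the classical fact that a function whose partial
derivatives exist near a point and are continuous there is differentiable at
that point ([C1_is_diff]): differentiability gives the continuity of [psi] on
[S], and the formula [D_v = sum_j v_j D_j] that identifies directional
derivatives with the Jacobian applied to [v].  It is proved by going from [x] to
[x + h] one coordinate at a time and applying the mean value theorem to each
leg ([telescoped_increment_le]). *)

(** * The mean value theorem along a line *)

Lemma line_is_derive (R : realType) (V : normedModType R) (f : V -> R)
    (x e : V) (s : R) :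
  derivable f (x + s *: e) e ->
  is_derive s 1 (fun t : R => f (x + t *: e)) ('D_e f (x + s *: e)).
Proof.
move=> df.
have shiftE : (fun h : R => h^-1 *:
      (((fun t : R => f (x + t *: e)) \o shift s) (h *: 1) - f (x + s *: e))) =
    (fun h : R => h^-1 *:
      ((f \o shift (x + s *: e)) (h *: e) - f (x + s *: e))).
  apply/funext => h /=; rewrite [h *: 1]mulr1 scalerDl.
  by rewrite addrCA.
by split; rewrite /derivable /derive /= shiftE.
Qed.

(** The two signs of [a] are the mean value theorem on [0, a] and on [a, 0]; both
yield this equation, which spares later estimates a case analysis. *)
Lemma MVT_line (R : realType) (V : normedModType R) (f : V -> R)
    (x e : V) (a : R) :
  (forall s : R, `|s| <= `|a| -> derivable f (x + s *: e) e) ->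
  exists2 s : R, `|s| <= `|a| & f (x + a *: e) - f x = 'D_e f (x + s *: e) * a.
Proof.
move=> df; pose g t := f (x + t *: e).
have dg (s : R) : `|s| <= `|a| -> is_derive s 1 g ('D_e f (x + s *: e)).
  by move=> sa; exact/line_is_derive/df.
have cg (p q : R) : (forall t, p <= t <= q -> `|t| <= `|a|) ->
    {within `[p, q], continuous g}.
  move=> pq; apply: derivable_within_continuous => t.
  by rewrite in_itv /= => /pq /dg [].
have g0 : g 0 = f x by rewrite /g scale0r addr0.
have [a0|a0] := leP 0 a.
  have in0a (t : R) : 0 <= t <= a -> `|t| <= `|a|.
    by case/andP => t0 ta; rewrite !ger0_norm.
  have [||s + gE] := @MVT_segment R g (fun s : R => 'D_e f (x + s *: e)) 0 a a0.
  - by move=> t /subset_itv_oo_cc; rewrite in_itv => /in0a /dg.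
  - exact: cg.
  by rewrite in_itv => /in0a sa; exists s => //; rewrite -g0 gE subr0.
have ina0 (t : R) : a <= t <= 0 -> `|t| <= `|a|.
  by case/andP => at_ t0; rewrite !ler0_norm ?lerN2// ltW.
have [||s + gE] :=
  @MVT_segment R g (fun s : R => 'D_e f (x + s *: e)) a 0 (ltW a0).
- by move=> t /subset_itv_oo_cc; rewrite in_itv => /ina0 /dg.
- exact: cg.
rewrite in_itv => /ina0 sa; exists s => //.
by rewrite -g0 -opprB gE sub0r mulrN opprK.
Qed.

(** * Partial derivatives continuous at a point give differentiability there *)

(** On a ball where each [D_(e j) f] stays [eps]-close to [c j], [f] follows the
linear prediction with relative error [eps].  The path from [x] to the end point
runs along the vectors [h j *: e j] in turn; since the [e j] have norm at most 1,
bounding [\sum_j `|h j|] by [r] keeps the whole path in the ball, and the mean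
value theorem bounds the error of leg [j] by [eps * `|h j|]. *)
Lemma telescoped_increment_le (R : realType) (V : normedModType R)
    (f : V -> R) (x : V) (J : eqType) (e : J -> V) (h c : J -> R)
    (r eps : R) :
  (forall j, `|e j| <= 1) ->
  (forall j z, `|z - x| < r ->
    derivable f z (e j) /\ `|'D_(e j) f z - c j| <= eps) ->
  forall s : seq J, \sum_(j <- s) `|h j| < r ->
  `|f (x + \sum_(j <- s) h j *: e j) - f x - \sum_(j <- s) h j * c j| <=
    eps * \sum_(j <- s) `|h j|.
Proof.
move=> e1 fx; elim => [|j s IHs].
  by rewrite !big_nil addr0 subrr subr0 normr0 mulr0.
(* The leg along [e j] is travelled last, starting from the point [y] that the
   induction hypothesis speaks of. *)
rewrite !big_cons => hr; set y := x + \sum_(i <- s) h i *: e i.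
have near_y (t : R) : `|t| <= `|h j| -> `|(y + t *: e j) - x| < r.
  move=> th; apply: le_lt_trans hr.
  rewrite [y + _]addrC -addrA [y - x]addrAC subrr add0r.
  apply: le_trans (ler_normD _ _) _; apply: lerD.
    by rewrite normrZ (le_trans _ th)// ler_piMr.
  apply: le_trans (ler_norm_sum _ _ _) _; apply: ler_sum => i _.
  by rewrite normrZ ler_piMr.
have [t th fE] := @MVT_line R V f y (e j) (h j)
  (fun t th => (fx j _ (near_y t th)).1).
have -> : x + (h j *: e j + \sum_(i <- s) h i *: e i) = y + h j *: e j.
  by rewrite addrCA addrC.
have -> : f (y + h j *: e j) - f x - (h j * c j + \sum_(i <- s) h i * c i) =
    ('D_(e j) f (y + t *: e j) - c j) * h j +
    (f y - f x - \sum_(i <- s) h i * c i).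
  rewrite mulrBl -fE; ring.
rewrite mulrDr; apply: le_trans (ler_normD _ _) _; apply: lerD.
  by rewrite normrM ler_wpM2r// (fx j _ (near_y t th)).2.
by apply: IHs; rewrite (le_lt_trans _ hr)// lerDr.
Qed.

Lemma coord_le_norm (R : realType) (k : nat) (h : 'rV[R]_k) (j : 'I_k) :
  `|h ord0 j| <= `|h|.
Proof.
rewrite /Num.norm /= mx_normrE.
exact: (le_bigmax _ (fun ij : 'I_1 * 'I_k => `|h ij.1 ij.2|) (ord0, j)).
Qed.

Lemma sum_coord_le_norm (R : realType) (k : nat) (h : 'rV[R]_k) :
  \sum_(j < k) `|h ord0 j| <= k%:R * `|h|.
Proof.
have -> : k%:R * `|h| = \sum_(j < k) `|h|.
  by rewrite sumr_const card_ord mulr_natl.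
by apply: ler_sum => j _; exact: coord_le_norm.
Qed.

Lemma basis_vector_norm_le1 (R : realType) (k : nat) (j : 'I_k) :
  `|basis_vector R j| <= 1.
Proof.
rewrite /Num.norm /= mx_normrE; apply/bigmax_le => // -[i l] _ /=.
by rewrite mxE; case: andP => _; rewrite ?normr1 ?normr0.
Qed.

Lemma row_sum_basis (R : realType) (k : nat) (h : 'rV[R]_k) :
  h = \sum_(j < k) h ord0 j *: basis_vector R j.
Proof. exact: row_sum_delta. Qed.

(** Named so that it can carry the linear structure that the uniqueness of the
differential asks of a candidate. *)
Definition dot (R : realType) (k : nat) (c : 'I_k -> R) (h : 'rV[R]_k) : R :=
  \sum_(j < k) h ord0 j * c j.

Lemma dot_is_linear (R : realType) (k : nat) (c : 'I_k -> R) :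
  linear (dot c).
Proof.
move=> a u v; rewrite /dot scaler_sumr -big_split /=; apply: eq_bigr => j _.
by rewrite !mxE mulrDl scalerAl.
Qed.

HB.instance Definition _ (R : realType) (k : nat) (c : 'I_k -> R) :=
  GRing.isLinear.Build R 'rV[R]_k R *:%R (dot c) (@dot_is_linear R k c).

Lemma dot_continuous (R : realType) (k : nat) (c : 'I_k -> R) :
  continuous (dot c).
Proof.
move=> h; apply: (@cvg_big _ _ _ _ _ _ _ (nbhs h)) => [|j _].
  exact: add_continuous.
by apply: cvgM; [exact: coord_continuous | exact: cvg_cst].
Qed.

Section C1_differentiable.
Variables (R : realType) (k : nat) (f : 'rV[R]_k -> R) (x : 'rV[R]_k).
Hypothesis f_derivable :
  forall j, \forall z \near x, derivable f z (basis_vector R j).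
Hypothesis f_C1 : forall j, {for x, continuous ('D_(basis_vector R j) f)}.

Let grad (j : 'I_k) : R := 'D_(basis_vector R j) f x.

(** The error [eps / k.+1] per leg absorbs the comparison of the sum of the
coordinates with the max norm; [k.+1] rather than [k] keeps the divisor
positive. *)
Lemma C1_expansion (eps : R) : 0 < eps ->
  \forall h \near (0 : 'rV[R]_k),
    `|f (h + x) - (f x + dot grad h)| <= eps * `|h|.
Proof.
move=> eps0.
have k0 : 0 < k.+1%:R :> R by rewrite ltr0n.
have epsk0 : 0 < eps / k.+1%:R by rewrite divr_gt0.
have : \forall z \near x, forall j, derivable f z (basis_vector R j) /\
    `|'D_(basis_vector R j) f z - grad j| <= eps / k.+1%:R.
  apply: (@filter_forall _ _ _ (nbhs x)) => j.
  apply: filterI; first exact: f_derivable.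
  exact: (cvgr_distC_le _ _ (@f_C1 j) _ epsk0).
case/nbhs_ballP => r /= r0; rewrite -ball_normE /= => fx.
have {}fx j z : `|z - x| < r -> derivable f z (basis_vector R j) /\
    `|'D_(basis_vector R j) f z - grad j| <= eps / k.+1%:R.
  by rewrite distrC => /fx /(_ j).
near=> h.
have hk : k%:R * `|h| < r.
  apply: (@le_lt_trans _ _ (k.+1%:R * `|h|)).
    by rewrite ler_wpM2r// ler_nat.
  rewrite mulrC -ltr_pdivlMr//; near: h.
  by apply: cvgr0_norm_lt; rewrite ?divr_gt0.
have hr := le_lt_trans (sum_coord_le_norm h) hk.
have fE := @telescoped_increment_le R _ f x _ (@basis_vector R k)
  (fun j => h ord0 j) grad r (eps / k.+1%:R) (@basis_vector_norm_le1 R k)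
  fx (index_enum 'I_k) hr.
rewrite [X in `|X|](_ : _ =
    f (x + \sum_(j < k) h ord0 j *: basis_vector R j) -
    f x - \sum_(j < k) h ord0 j * grad j); last first.
  by rewrite -row_sum_basis opprD addrA [h + x]addrC.
apply: le_trans fE _.
apply: (@le_trans _ _ (eps / k.+1%:R * (k.+1%:R * `|h|))).
  apply: ler_wpM2l; first exact: ltW.
  apply: le_trans (sum_coord_le_norm h) _.
  by rewrite ler_wpM2r// ler_nat.
by rewrite mulrA divfK ?gt_eqF.
Unshelve. all: by end_near. Qed.

Lemma C1_is_diff : is_diff x f (dot grad).
Proof.
have fE := (@eqaddoP _ _ _ _ _ (f \o shift x) (cst (f x) + dot grad) id).2
  C1_expansion.
have dE := diff_unique (@dot_continuous R k grad) fE.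
split=> //; apply/diff_locallyP; rewrite dE; split=> //.
exact: dot_continuous.
Qed.

Lemma C1_derive (v : 'rV[R]_k) :
  'D_v f x = \sum_(j < k) v ord0 j * 'D_(basis_vector R j) f x.
Proof.
have fdiff := C1_is_diff.
by rewrite deriveE; [rewrite diff_val | exact: ex_diff].
Qed.
End C1_differentiable.

(** * Moving all the components in the same direction *)

(** Multiplying the increment by [t] makes its sign that of [t], which covers the
steps forward and backward in one statement. *)
Lemma derive_gt0_sign (R : realType) (V : normedModType R) (f : V -> R)
    (x v : V) :
  derivable f x v -> 0 < 'D_v f x ->
  \forall t \near 0^', 0 < t * (f (x + t *: v) - f x).
Proof.
move=> df Df0.
have quot_gt0 : \forall t \near 0^', 0 < t^-1 * (f (x + t *: v) - f x).
  apply: filterS (cvgr_gt _ df _ Df0) => t.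
  by rewrite /= [_ *: _ + x]addrC.
near=> t; have q0 : 0 < t^-1 * (f (x + t *: v) - f x) by near: t.
have t0 : t != 0 by near: t; exact: nbhs_dnbhs_neq.
have -> : t * (f (x + t *: v) - f x) =
    t ^+ 2 * (t^-1 * (f (x + t *: v) - f x)).
  by rewrite expr2 -mulrA mulVKf.
by rewrite mulr_gt0// exprn_even_gt0.
Unshelve. all: by end_near. Qed.

Section C1_map.
Variables (R : realType) (k : nat) (S : set 'rV[R]_k).
Variable psi : 'rV[R]_k -> 'rV[R]_k.
Hypothesis psi_C1 : C1_on psi S.

Lemma C1_on_differentiable eta (i : 'I_k) :
  S eta -> differentiable (component psi i) eta.
Proof.
move=> Seta; apply: (@ex_diff _ _ _ _ _ _ _ (C1_is_diff _ _)) => j.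
  exact: (psi_C1 Seta i j).1.
exact: (psi_C1 Seta i j).2.
Qed.

Lemma Jacobian_derive eta (v : 'rV[R]_k) (i : 'I_k) : S eta ->
  'D_v (component psi i) eta = (v *m (Jacobian psi eta)^T) ord0 i.
Proof.
move=> Seta; rewrite C1_derive => [|j|j].
- by rewrite mxE; apply: eq_bigr => j _; rewrite !mxE.
- exact: (psi_C1 Seta i j).1.
- exact: (psi_C1 Seta i j).2.
Qed.

(** The unknown is a row vector, so the system to solve is the transpose of
[J v = (1, ..., 1)]. *)
Lemma ascent_direction eta : S eta -> \det (Jacobian psi eta) != 0 ->
  exists v, forall i, 'D_v (component psi i) eta = 1.
Proof.
move=> Seta detJ; exists (const_mx 1 *m invmx (Jacobian psi eta)^T) => i.
by rewrite Jacobian_derive// mulmxKV ?mxE// unitmxE det_tr unitfE.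
Qed.

Lemma interior_straddled eta :
  interior S eta -> \det (Jacobian psi eta) != 0 ->
  (exists2 z, S z & forall i, psi eta ord0 i < psi z ord0 i) /\
  (exists2 z, S z & forall i, psi z ord0 i < psi eta ord0 i).
Proof.
move=> intS detJ; have Seta := interior_subset intS.
have [v Dv] := ascent_direction Seta detJ.
have cline : (eta + t *: v) @[t --> (0 : R)] --> eta.
  rewrite -[X in _ --> X]addr0 -(scale0r v).
  by apply: cvgD; [exact: cvg_cst | apply: cvgZr_tmp; exact: cvg_id].
have : \forall t \near (0 : R)^', S (eta + t *: v) /\ forall i,
    0 < t * (psi (eta + t *: v) ord0 i - psi eta ord0 i).
  apply: filterI; first exact/cvg_within/cline.
  apply: (@filter_forall _ _ _ (0 : R)^') => i.
  apply: (@derive_gt0_sign _ _ (component psi i)); last by rewrite Dv.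
  exact/diff_derivable/C1_on_differentiable.
rewrite near_withinE => /nbhs_ballP[r /= r0]; rewrite -ball_normE /= => near0.
have step t : `|t| < r -> t != 0 -> S (eta + t *: v) /\ forall i,
    0 < t * (psi (eta + t *: v) ord0 i - psi eta ord0 i).
  by move=> tr; apply: near0; rewrite /= sub0r normrN.
have r20 : 0 < r / 2 by rewrite divr_gt0.
have r2r : `|r / 2| < r by rewrite gtr0_norm// ltr_pdivrMr// ltr_pMr// ltr1n.
split.
  have [Sz psiz] := step (r / 2) r2r (lt0r_neq0 r20).
  exists (eta + (r / 2) *: v) => // i.
  by have := psiz i; rewrite pmulr_rgt0// subr_gt0.
have [||Sz psiz] := step (- (r / 2)); rewrite ?normrN ?oppr_eq0 ?lt0r_neq0//.
exists (eta + (- (r / 2)) *: v) => // i.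
by have := psiz i; rewrite nmulr_rgt0 ?oppr_lt0// subr_lt0.
Qed.

(** * Existence *)

Lemma exists_extremal_point :
  S !=set0 -> compact S -> extremal_points psi S !=set0.
Proof.
move=> S0 cS; pose total z := \sum_(i < k) component psi i z.
have [|eta etaS eta_max] := @compact_EVT_max _ R total S S0 cS.
  apply: continuous_in_subspaceT => z /set_mem Sz.
  apply: (@cvg_big _ _ _ _ _ _ _ (nbhs z)) => [|i _].
    exact: add_continuous.
  exact/differentiable_continuous/C1_on_differentiable.
exists eta; split; first exact: set_mem.
left; split; first by exists eta => //; exact: set_mem.
case=> _ [z Sz <-] [psi_ge [p psi_gt]].
have := eta_max z (mem_set Sz); rewrite leNgt => /negP; apply.
rewrite /total (bigD1 p)//= [ltRHS](bigD1 p)//=; apply: ltr_leD.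
  by move: psi_gt; rewrite !mxE subr_gt0.
by apply: ler_sum => i _; have := psi_ge i; rewrite !mxE subr_ge0.
Qed.
End C1_map.

Unset Implicit Arguments.

Theorem theorem4p7 (R : realType) (k : nat) (hk : (1 <= k)%N)
    (S : set 'rV[R]_k) (psi : 'rV[R]_k -> 'rV[R]_k)
    (S_nonempty : S !=set0)
    (psi_C1 : C1_on psi S)
    (S_closed : closed S)
    (S_bounded : bounded_set S)
    (det_neq0 : forall eta, S eta -> \det (Jacobian psi eta) != 0) :
  extremal_points psi S !=set0 /\
  extremal_points psi S `<=` boundary S.
Proof.
split.
  exact: exists_extremal_point psi_C1 S_nonempty
    (bounded_closed_compact S_bounded S_closed).
move=> eta [Seta extr]; split; first exact: subset_closure.
move=> intS; have [[z Sz z_gt] [y Sy y_lt]] :=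
  interior_straddled psi_C1 intS (det_neq0 eta Seta).
have vgt_all (X Y : 'rV[R]_k) : (forall i, Y ord0 i < X ord0 i) -> vgt X Y.
  move=> YX; split => [i|]; first by rewrite !mxE subr_ge0 ltW.
  by exists (Ordinal hk); rewrite !mxE subr_gt0.
case: extr => -[_]; apply.
  by exists (psi z); [exists z | exact: vgt_all].
by exists (psi y); [exists y | exact: vgt_all].
Qed.
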